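(* Let $\mathbb F$ be a field with $\operatorname{char}\mathbb F=0$ and let $n\geq 1$. Then for every $n\times n$ matrix $\Lambda=(\lambda_{i,j})$ over $\mathbb F$ with non-zero entries such that $\lambda_{j,i}=\lambda_{i,j}^{-1}$ for $1\leq i,j\leq n$ and $\lambda_{i,i}=1$ for $1\leq i\leq n$, the algebra $A_n^{\Lambda}$ is simple.
   Context: $A_n^{\Lambda}$ is the $\mathbb F$-algebra generated by $y_1,x_1,\ldots,y_n,x_n$ subject to the relations $$y_jy_i=\lambda_{j,i}y_iy_j,\quad y_jx_i=\lambda_{i,j}x_iy_j,\quad x_jy_i=\lambda_{i,j}y_ix_j,\quad x_jx_i=\lambda_{j,i}x_ix_j\qquad(1\leq i<j\leq n),$$ $$x_jy_j-y_jx_j=1\qquad(1\leq j\leq n).$$ *)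

(* Defs.v *)
From HB Require Import structures.
From mathcomp Require Import all_boot all_algebra.
From mathcomp Require Import boolp classical_sets.
From mathcomp Require Import finmap monalg.

Set Implicit Arguments.
Unset Strict Implicit.
Unset Printing Implicit Defensive.

Import GRing.Theory.

Local Open Scope classical_set_scope.
Local Open Scope quotient_scope.
Local Open Scope ring_scope.

(* In a unital algebra, ring ideals are automatically stable under scalars
   (k *: u = k%:A * u), so no separate notion of algebra ideal is needed. *)
Definition two_sided_ideal (A : pzRingType) (I : set A) : Prop :=
  [/\ I 0,
      forall u v, I u -> I v -> I (u + v),
      forall a u, I u -> I (a * u)
    & forall a u, I u -> I (u * a)].

Definition simple_ring (A : pzRingType) : Prop :=
  1 != 0 :> A /\
  forall I : set A, two_sided_ideal I -> I = [set 0] \/ I = setT.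

Definition ideal_span (A : pzRingType) (S : set A) : set A :=
  [set u | forall I : set A, two_sided_ideal I -> S `<=` I -> I u].

Lemma ideal_spanP (A : pzRingType) (S : set A) :
  two_sided_ideal (ideal_span S).
Proof.
split=> [I [] //|u v Iu Iv I hI hS|a u Iu I hI hS|a u Iu I hI hS].
- by have [_ hD _ _] := hI; apply: hD; [exact: Iu | exact: Iv].
- by have [_ _ hl _] := hI; apply: hl; exact: Iu.
- by have [_ _ _ hr] := hI; apply: hr; exact: Iu.
Qed.

Lemma ideal_span_sub (A : pzRingType) (S : set A) : S `<=` ideal_span S.
Proof. by move=> u Su I _; apply. Qed.

Definition ideal_span_pred (A : pzRingType) (S : set A) : A -> bool :=
  fun u => `[< ideal_span S u >].

Section IdealSpanPred.
Variables (A : pzRingType) (S : set A).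

Lemma ideal_span_predE u : (u \in ideal_span_pred S) = `[< ideal_span S u >].
Proof. by []. Qed.

Lemma ideal_span_zmod_closed : zmod_closed (ideal_span_pred S).
Proof.
have [I0 ID Il Ir] := ideal_spanP S.
split=> [|u v]; rewrite !ideal_span_predE; first exact/asboolP.
move=> /asboolP Iu /asboolP Iv; apply/asboolP; apply: (ID _ _ Iu).
by rewrite -mulN1r; exact: Il.
Qed.

HB.instance Definition _ :=
  GRing.isZmodClosed.Build A (ideal_span_pred S) ideal_span_zmod_closed.

Definition ideal_span_zmod : zmodClosed A :=
  GRing.ZmodClosed.clone A (ideal_span_pred S) _.

Lemma ideal_span_predMl a u :
  u \in ideal_span_pred S -> a * u \in ideal_span_pred S.
Proof.
have [_ _ h _] := ideal_spanP S; rewrite !ideal_span_predE => /asboolP Iu.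
by apply/asboolP; apply: h.
Qed.

Lemma ideal_span_predMr a u :
  u \in ideal_span_pred S -> u * a \in ideal_span_pred S.
Proof.
have [_ _ _ h] := ideal_spanP S; rewrite !ideal_span_predE => /asboolP Iu.
by apply/asboolP; apply: h.
Qed.
End IdealSpanPred.

(* The quotient of A by the two-sided ideal generated by S.  It is not an
   algType: that structure requires 1 != 0, which fails when S generates A.
   It is therefore equipped with its lmodType and pzRingType structures, and
   presented_scaleAl and presented_scaleAr are the axioms linking them. *)
Definition presented (A : pzRingType) (S : set A) : Type :=
  {ideal_quot (ideal_span_zmod S)}.

Section PresentedRing.
Variables (A : pzRingType) (S : set A).
Local Notation Q := (presented S).
Local Notation Q0 := {ideal_quot (ideal_span_zmod S)}.

HB.instance Definition _ := GRing.Zmodule.copy Q Q0.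

Definition presented_pi : A -> Q := \pi_Q0.
Definition presented_repr : Q -> A := @repr A Q0.

Lemma presented_reprK : cancel presented_repr presented_pi.
Proof. exact: reprK. Qed.

Lemma presented_piP u v :
  (presented_pi u = presented_pi v) <-> (u - v \in ideal_span_pred S).
Proof.
by rewrite Quotient.idealrBE; split=> [h|/eqP //]; apply/eqP; exact: h.
Qed.

Lemma presented_pi_is_zmod_morphism : zmod_morphism presented_pi.
Proof. exact: (@raddfB _ _ \pi_Q0). Qed.

HB.instance Definition _ :=
  GRing.isZmodMorphism.Build A Q presented_pi presented_pi_is_zmod_morphism.

Definition presented_one : Q := presented_pi 1.
Definition presented_mul (u v : Q) : Q :=
  presented_pi (presented_repr u * presented_repr v).

Lemma presented_piM u v :
  presented_pi (u * v) = presented_mul (presented_pi u) (presented_pi v).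
Proof.
apply/presented_piP; set u' := presented_repr _; set v' := presented_repr _.
have hu : u - u' \in ideal_span_pred S.
  by apply/presented_piP; rewrite presented_reprK.
have hv : v - v' \in ideal_span_pred S.
  by apply/presented_piP; rewrite presented_reprK.
have -> : u * v - u' * v' = (u - u') * v + u' * (v - v').
  by rewrite mulrBl mulrBr addrA subrK.
by apply: rpredD; [exact: ideal_span_predMr | exact: ideal_span_predMl].
Qed.

Lemma presented_mulA : associative presented_mul.
Proof.
move=> u v w; rewrite -[u]presented_reprK -[v]presented_reprK.
by rewrite -[w]presented_reprK -!presented_piM mulrA.
Qed.

Lemma presented_mul1l : left_id presented_one presented_mul.
Proof. by move=> u; rewrite -[u]presented_reprK -presented_piM mul1r. Qed.

Lemma presented_mul1r : right_id presented_one presented_mul.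
Proof. by move=> u; rewrite -[u]presented_reprK -presented_piM mulr1. Qed.

Lemma presented_mulDl : left_distributive presented_mul +%R.
Proof.
move=> u v w; rewrite -[u]presented_reprK -[v]presented_reprK.
by rewrite -[w]presented_reprK -raddfD -!presented_piM -raddfD mulrDl.
Qed.

Lemma presented_mulDr : right_distributive presented_mul +%R.
Proof.
move=> u v w; rewrite -[u]presented_reprK -[v]presented_reprK.
by rewrite -[w]presented_reprK -raddfD -!presented_piM -raddfD mulrDr.
Qed.

HB.instance Definition _ := GRing.Zmodule_isPzRing.Build Q
  presented_mulA presented_mul1l presented_mul1r
  presented_mulDl presented_mulDr.

Lemma presented_pi_is_monoid_morphism : monoid_morphism presented_pi.
Proof. by split=> // u v; exact: presented_piM. Qed.

HB.instance Definition _ :=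
  GRing.isMonoidMorphism.Build A Q presented_pi presented_pi_is_monoid_morphism.
End PresentedRing.

Section PresentedModule.
Variables (F : comNzRingType) (A : lalgType F) (S : set A).
Local Notation Q := (presented S).
Local Notation pi := (@presented_pi A S).
Local Notation repr := (@presented_repr A S).

Definition presented_scale (k : F) (u : Q) : Q := pi (k *: repr u).

Lemma presented_piZ k u : pi (k *: u) = presented_scale k (pi u).
Proof.
rewrite /presented_scale -[k *: u]mulr_algl -[k *: repr _]mulr_algl.
by rewrite !rmorphM /= presented_reprK.
Qed.

Lemma presented_scaleA k l u :
  presented_scale k (presented_scale l u) = presented_scale (k * l) u.
Proof. by rewrite -[u]presented_reprK -!presented_piZ scalerA. Qed.

Lemma presented_scale1 : left_id 1 presented_scale.
Proof. by move=> u; rewrite -[u]presented_reprK -presented_piZ scale1r. Qed.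

Lemma presented_scaleDr : right_distributive presented_scale +%R.
Proof.
move=> k u v; rewrite -[u]presented_reprK -[v]presented_reprK.
by rewrite -raddfD -!presented_piZ -raddfD scalerDr.
Qed.

Lemma presented_scaleDl u :
  {morph presented_scale^~ u : k l / k + l}.
Proof.
move=> k l; rewrite -[u]presented_reprK.
by rewrite -!presented_piZ -raddfD scalerDl.
Qed.

HB.instance Definition _ := GRing.Zmodule_isLmodule.Build F Q
  presented_scaleA presented_scale1 presented_scaleDr presented_scaleDl.

Lemma presented_pi_is_scalable : scalable pi.
Proof. by move=> k u; exact: presented_piZ. Qed.

HB.instance Definition _ :=
  GRing.isScalable.Build F A Q *:%R pi presented_pi_is_scalable.

Lemma presented_scaleAl (k : F) (u v : Q) : k *: (u * v) = k *: u * v.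
Proof.
rewrite -[u]presented_reprK -[v]presented_reprK.
by rewrite -rmorphM -!linearZ -rmorphM scalerAl.
Qed.
End PresentedModule.

Lemma presented_scaleAr (F : comNzRingType) (A : algType F) (S : set A)
  (k : F) (u v : presented S) : k *: (u * v) = u * (k *: v).
Proof.
rewrite -[u]presented_reprK -[v]presented_reprK.
by rewrite -rmorphM -!linearZ -rmorphM scalerAr.
Qed.

Section FreeAlgebra.
Variables (F : comNzRingType) (X : choiceType).

(* {fmonom X} is the free (noncommutative) monoid of words over X. *)
Definition free_alg : Type := {malg F[{fmonom X}]}.

HB.instance Definition _ := GRing.Lalgebra.on free_alg.

Lemma free_alg_scaleAr (k : F) (u v : free_alg) : k *: (u * v) = u * (k *: v).
Proof.
apply/malgP => m; rewrite mcoeffZ (mcoeffMlw m (fsubset_refl _) (fsubset_refl _)).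
rewrite (mcoeffMlw m (fsubset_refl _) (msuppZ_le k v)) mulr_sumr.
apply: eq_bigr => m1 _; rewrite mulr_sumr; apply: eq_bigr => m2 _.
by rewrite mcoeffZ mulrnAr mulrCA.
Qed.

HB.instance Definition _ :=
  GRing.Lalgebra_isAlgebra.Build F free_alg free_alg_scaleAr.

Definition free_gen (a : X) : free_alg := mkmalgU (fmu a) 1.
End FreeAlgebra.

Section MultiparameterWeyl.
Variables (F : comNzRingType) (n : nat) (L : 'M[F]_n).

Local Notation Fyx := (free_alg F ('I_n + 'I_n)%type).

Definition free_y (j : 'I_n) : Fyx := free_gen F (inl j).
Definition free_x (j : 'I_n) : Fyx := free_gen F (inr j).

Local Notation y := free_y.
Local Notation x := free_x.

Inductive weyl_relator : Fyx -> Prop :=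
| Weyl_yy (i j : 'I_n) of (i < j)%N :
    weyl_relator (y j * y i - L j i *: (y i * y j))
| Weyl_yx (i j : 'I_n) of (i < j)%N :
    weyl_relator (y j * x i - L i j *: (x i * y j))
| Weyl_xy (i j : 'I_n) of (i < j)%N :
    weyl_relator (x j * y i - L i j *: (y i * x j))
| Weyl_xx (i j : 'I_n) of (i < j)%N :
    weyl_relator (x j * x i - L j i *: (x i * x j))
| Weyl_comm (j : 'I_n) :
    weyl_relator (x j * y j - y j * x j - 1).

Definition weyl_alg : Type := presented weyl_relator.

HB.instance Definition _ := GRing.PzRing.on weyl_alg.
HB.instance Definition _ := GRing.Lmodule.on weyl_alg.
End MultiparameterWeyl.

(* Main.v *)
(** Give y_j and x_j the weights e_j and -e_j in Z^n.  Since ad (y_j x_j) acts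
    on the space of weight p as the scalar p_j and the characteristic is 0, an
    ideal contains the weight components of its elements.  On the space of
    weight p, a twisted commutator with y_j or x_j lowers the word length by
    one, and an analogue of Euler's identity shows that an element killed by
    all of them is a scalar.  So a nonzero homogeneous element of an ideal is
    brought down to a nonzero scalar, without any normal form for words.  That
    1 is not 0 follows from an action on functions Z^n -> F by twisted
    shifts. *)

Require Import Defs.
From HB Require Import structures.
From mathcomp Require Import all_boot all_algebra.
From mathcomp Require Import boolp classical_sets monalg.
From mathcomp Require Import ring.

Set Implicit Arguments.
Unset Strict Implicit.
Unset Printing Implicit Defensive.

Import GRing.Theory.

Local Open Scope ring_scope.

(** * Auxiliary facts on scalars, letter counts and ideals *)

Lemma natf_neq0 (F : fieldType) (m : nat) :
  [pchar F] =i pred0 -> (m.+1%:R : F) != 0.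
Proof. by move=> /pcharf0P->. Qed.

Lemma intf_neq0 (F : fieldType) (z : int) :
  [pchar F] =i pred0 -> z != 0 -> (z%:~R : F) != 0.
Proof.
move=> charF0; case: z => [[|m]|m] // _; first exact: natf_neq0.
by rewrite NegzE mulrNz oppr_eq0; exact: natf_neq0.
Qed.

Lemma sum_count_mem (T : finType) (w : seq T) :
  (\sum_(a : T) count_mem a w = size w)%N.
Proof.
elim: w => [|b w IH] /=; first by rewrite big1.
rewrite big_split /= IH (bigD1 b) //= eqxx big1 ?addn0 // => a.
by rewrite eq_sym => /negPf ->.
Qed.

Lemma idealB (A : pzRingType) (I : set A) u v :
  two_sided_ideal I -> I u -> I v -> I (u - v).
Proof.
by case=> _ ID Il _ Iu Iv; apply: ID => //; rewrite -mulN1r; exact: Il.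
Qed.

Lemma ideal_sum (A : pzRingType) (I : set A) J (s : seq J) (P : pred J)
    (G : J -> A) :
  two_sided_ideal I -> (forall j, P j -> I (G j)) ->
  I (\sum_(j <- s | P j) G j).
Proof. by case=> I0 ID _ _ IG; elim/big_ind: _. Qed.

Lemma idealZ (R : comNzRingType) (A : lalgType R) (I : set A) c u :
  two_sided_ideal I -> I u -> I (c *: u).
Proof. by move=> [_ _ Il _] Iu; rewrite -mulr_algl; exact: Il. Qed.

Lemma mkmalgUM (R : comNzRingType) (X : choiceType) (c d : R)
    (v w : {fmonom X}) :
  (mkmalgU v c : free_alg R X) * mkmalgU w d = mkmalgU (mmul v w) (c * d).
Proof. by rewrite [LHS]malgM_def fgmulUU. Qed.

Section TwistedWeyl.
Variables (F : fieldType) (n : nat) (L : 'M[F]_n).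

Local Notation letter := ('I_n + 'I_n)%type.
Local Notation weight := {ffun 'I_n -> int}.

(** * Weights of letters and words *)

Definition delta (j : 'I_n) : weight := [ffun i => (i == j)%:R].

Definition letter_wt (a : letter) : weight :=
  match a with inl j => delta j | inr j => - delta j end.

Definition word_wt (w : seq letter) : weight := \sum_(a <- w) letter_wt a.

Lemma word_wt_cons a w : word_wt (a :: w) = letter_wt a + word_wt w.
Proof. exact: big_cons. Qed.

Lemma word_wt_cat w1 w2 : word_wt (w1 ++ w2) = word_wt w1 + word_wt w2.
Proof. exact: big_cat. Qed.

Hypothesis L_neq0 : forall i j : 'I_n, L i j != 0.
Hypothesis L_inv : forall i j : 'I_n, L j i = (L i j)^-1.

(** * The action on functions of weights *)

Definition shift_coef (j : 'I_n) (p : weight) : F :=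
  \prod_(i < n | (i < j)%N) L i j ^ p i.

Lemma shift_coef_neq0 j p : shift_coef j p != 0.
Proof. by apply/prodf_neq0 => i _; rewrite expfz_neq0. Qed.

Lemma shift_coefD j p q :
  shift_coef j (p + q) = shift_coef j p * shift_coef j q.
Proof.
by rewrite -big_split; apply: eq_bigr => i _; rewrite ffunE expfzDr.
Qed.

Lemma shift_coefN j p : shift_coef j (- p) = (shift_coef j p)^-1.
Proof.
rewrite -prodfV; apply: eq_bigr => i _.
by rewrite ffunE -invr_expz.
Qed.

Lemma shift_coef_delta_lt (i j : 'I_n) :
  (i < j)%N -> shift_coef j (delta i) = L i j.
Proof.
move=> lt_ij; rewrite /shift_coef (bigD1 i) //= big1 => [|k /andP[_ ne_ki]].
  by rewrite ffunE eqxx mulr1.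
by rewrite ffunE (negPf ne_ki).
Qed.

Lemma shift_coef_delta_ge (i j : 'I_n) :
  (j <= i)%N -> shift_coef j (delta i) = 1.
Proof.
move=> le_ji; rewrite /shift_coef big1 => // k lt_kj.
by rewrite ffunE; case: eqP lt_kj => // ->; rewrite ltnNge le_ji.
Qed.

(** If functions of weights are read as coefficients of formal Laurent series in t_1, ..., t_n, then
    y_j acts as multiplication by t_j and x_j as the partial derivative in t_j, up to the twist
    [shift_coef]. *)
Definition letter_coef (a : letter) (p : weight) : F :=
  match a with
  | inl j => (shift_coef j p)^-1
  | inr j => shift_coef j p * (p j + 1)%:~R
  end.

Fixpoint word_coef (w : seq letter) (p : weight) : F :=
  if w is a :: w' then letter_coef a p * word_coef w' (p - letter_wt a) else 1.

Lemma word_coef_cat w1 w2 p :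
  word_coef (w1 ++ w2) p = word_coef w1 p * word_coef w2 (p - word_wt w1).
Proof.
elim: w1 p => [|a w1 IH] p /=.
  by rewrite mul1r /word_wt big_nil subr0.
by rewrite IH word_wt_cons opprD addrA mulrA.
Qed.

Definition word_act (w : {fmonom letter}) (f : weight -> F) (p : weight) : F :=
  word_coef w p * f (p - word_wt w).

Definition shift_act (u : free_alg F letter) (f : weight -> F) (p : weight) :=
  mmap idfun (fun w => word_act w f p) u.

Lemma shift_act0 f p : shift_act 0 f p = 0.
Proof. exact: mmap0. Qed.

Lemma shift_actD u v f p :
  shift_act (u + v) f p = shift_act u f p + shift_act v f p.
Proof. exact: mmapD. Qed.

Lemma shift_actB u v f p :
  shift_act (u - v) f p = shift_act u f p - shift_act v f p.
Proof. exact: mmapB. Qed.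

Lemma shift_actZ c u f p : shift_act (c *: u) f p = c * shift_act u f p.
Proof.
rewrite /shift_act (mmapEw (msuppZ_le _ _)) mmapE mulr_sumr.
by apply: eq_bigr => w _; rewrite mcoeffZ -mulrA.
Qed.

Lemma shift_act_sum I (s : seq I) (G : I -> free_alg F letter) f p :
  shift_act (\sum_(i <- s) G i) f p = \sum_(i <- s) shift_act (G i) f p.
Proof.
by apply: (big_morph (fun u => shift_act u f p)) => [u v|];
  [exact: shift_actD | exact: shift_act0].
Qed.

Lemma shift_actU c w f p :
  shift_act (mkmalgU w c : free_alg F letter) f p = c * word_act w f p.
Proof. exact: mmapU. Qed.

Lemma shift_actM u v f p :
  shift_act (u * v) f p = shift_act u (shift_act v f) p.
Proof.
rewrite [u]monalgE mulr_suml !shift_act_sum; apply: eq_bigr => w1 _.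
rewrite shift_actU /word_act [v]monalgE mulr_sumr !shift_act_sum !mulr_sumr.
apply: eq_bigr => w2 _.
rewrite mkmalgUM !shift_actU /word_act fmM word_coef_cat word_wt_cat.
by rewrite opprD addrA; ring.
Qed.

Lemma shift_act_y j f p :
  shift_act (free_y F j) f p = (shift_coef j p)^-1 * f (p - delta j).
Proof.
rewrite shift_actU /word_act fmU /= !mulr1 mul1r.
by rewrite word_wt_cons /word_wt big_nil addr0.
Qed.

Lemma shift_act_x j f p :
  shift_act (free_x F j) f p
  = shift_coef j p * (p j + 1)%:~R * f (p + delta j).
Proof.
rewrite shift_actU /word_act fmU /= !mulr1 mul1r.
by rewrite word_wt_cons /word_wt big_nil addr0 opprK.
Qed.

Lemma shift_act1 f p : shift_act 1 f p = f p.
Proof.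
rewrite -[1](@mpolyC1E {fmonom letter} F).
by rewrite shift_actU /word_act fm1 /= /word_wt big_nil subr0 !mul1r.
Qed.

Lemma shift_act_qcommutator c u v w z f p :
  shift_act (u * v - c *: (w * z)) f p
  = shift_act u (shift_act v f) p - c * shift_act w (shift_act z f) p.
Proof. by rewrite shift_actB shift_actZ (shift_actM u) (shift_actM w). Qed.

(** Plain shifts commute, so only scalars are compared. For i < j, a shift by [delta i] multiplies
    [shift_coef j] by [L i j], while a shift by [delta j] leaves [shift_coef i] unchanged; this
    asymmetry produces the four twisted relations. The last relator vanishes because (p_j + 1) - p_j
    = 1. *)
Lemma shift_act_relator u f p : weyl_relator L u -> shift_act u f p = 0.
Proof.
have ne := (shift_coef_neq0, L_neq0, oner_neq0).
pose wtE := (shift_coefD, shift_coefN).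
have ltE (i j : 'I_n) (lt_ij : (i < j)%N) :=
  (shift_coef_delta_lt lt_ij, shift_coef_delta_ge (ltnW lt_ij), L_inv i j).
case=> [i j lt_ij|i j lt_ij|i j lt_ij|i j lt_ij|j].
- rewrite shift_act_qcommutator (shift_act_y j) (shift_act_y i).
  rewrite (shift_act_y i) (shift_act_y j) !wtE !(ltE i j) //.
  by rewrite [p - _ - _]addrAC; field; rewrite !ne.
- rewrite shift_act_qcommutator (shift_act_y j) (shift_act_x i).
  rewrite (shift_act_x i) (shift_act_y j) !wtE !(ltE i j) // [p - _ + _]addrAC.
  by rewrite !ffunE -!val_eqE /= (ltn_eqF lt_ij) subr0; field; rewrite !ne.
- rewrite shift_act_qcommutator (shift_act_x j) (shift_act_y i).
  rewrite (shift_act_y i) (shift_act_x j) !wtE !(ltE i j) // [p - _ + _]addrAC.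
  by rewrite !ffunE -!val_eqE /= (gtn_eqF lt_ij) subr0; field; rewrite !ne.
- rewrite shift_act_qcommutator (shift_act_x j) (shift_act_x i).
  rewrite (shift_act_x i) (shift_act_x j) !wtE !(ltE i j) // [p + _ + _]addrAC.
  rewrite !ffunE -!val_eqE /= (gtn_eqF lt_ij) (ltn_eqF lt_ij) !addr0.
  by field; rewrite !ne.
(* The scalar 1 is inserted to reach the form of [shift_act_qcommutator]. *)
- rewrite shift_actB -[free_y F j * free_x F j]scale1r shift_act_qcommutator.
  rewrite (shift_act_x j) (shift_act_y j) (shift_act_y j) (shift_act_x j).
  rewrite shift_act1 !wtE !shift_coef_delta_ge // addrK subrK !ffunE eqxx.
  by rewrite subrK intrD; field; rewrite !ne.
Qed.

(** The annihilator [J] of the action is a two-sided ideal containing the relators, so it contains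
    the ideal they span; but 1 acts as the identity. *)
Lemma weyl_alg_nontrivial : 1 != 0 :> weyl_alg L.
Proof.
pose J (u : free_alg F letter) := forall f p, shift_act u f p = 0.
have J_ideal : two_sided_ideal J.
  split=> [f p|u v Ju Jv f p|u v Jv f p|u v Jv f p].
  - exact: shift_act0.
  - by rewrite shift_actD Ju Jv addr0.
  - rewrite shift_actM (_ : shift_act v f = fun=> 0); last exact/funext.
    by rewrite /shift_act mmapE big1 // => w _; rewrite /word_act !mulr0.
  - by rewrite shift_actM Jv.
apply/eqP => eq10.
have /presented_piP : @presented_pi _ (weyl_relator L) 1 = presented_pi _ 0.
  by rewrite raddf0.
rewrite subr0 => /asboolP /(_ J J_ideal) J1.
have /(_ (fun=> 1) 0) := J1 (fun u rel_u f p => shift_act_relator f p rel_u).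
by rewrite shift_act1 => /eqP; rewrite oner_eq0.
Qed.

(** * Twisted commutators *)

Definition dual (a : letter) : letter :=
  match a with inl j => inr j | inr j => inl j end.

Lemma dualK : involutive dual.
Proof. by case. Qed.

Lemma letter_wt_dual a : letter_wt (dual a) = - letter_wt a.
Proof. by case: a => j //=; rewrite opprK. Qed.

(** Together with [comm_const], this puts all the relations, for the two letters in either order,
    into one formula: the hypothesis [g_comm] below. *)
Definition comm_factor (a b : letter) : F :=
  match a, b with
  | inl j, inl i | inr j, inr i => L j i
  | inl j, inr i | inr j, inl i => L i j
  end.

Definition comm_const (a b : letter) : F :=
  match a, b with
  | inr j, inl i => (i == j)%:R
  | inl j, inr i => - (i == j)%:R
  | _, _ => 0
  end.

Lemma comm_const_neq_dual a b : b != dual a -> comm_const a b = 0.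
Proof.
case: a b => j [] i //=; rewrite (inj_eq inl_inj) || rewrite (inj_eq inr_inj);
by move=> /negPf->; rewrite ?oppr0.
Qed.

Lemma comm_const_dual_sqr a : comm_const a (dual a) * comm_const a (dual a) = 1.
Proof. by case: a => j /=; rewrite eqxx ?mulrNN mulr1. Qed.

Lemma comm_factor_dual a b : comm_factor (dual a) b * comm_factor a b = 1.
Proof.
by case: a b => j [] i /=; rewrite ?(L_inv i j) ?mulfV ?mulVf.
Qed.

Lemma comm_factor_dualr a b : comm_factor a (dual b) = (comm_factor a b)^-1.
Proof. by case: a b => j [] i /=; rewrite L_inv. Qed.

Lemma comm_factor_neq0 a b : comm_factor a b != 0.
Proof. by case: a b => j [] i /=. Qed.

(** The character of Z^n giving the scalar picked up when [a] moves past a word of weight [p]. The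
    letters y_i determine it, since x_i has the opposite weight and the inverse factor. *)
Definition comm_char (a : letter) (p : weight) : F :=
  \prod_i comm_factor a (inl i) ^ p i.

Lemma comm_char0 a : comm_char a 0 = 1.
Proof. by apply: big1 => i _; rewrite ffunE. Qed.

Lemma comm_charD a p q : comm_char a (p + q) = comm_char a p * comm_char a q.
Proof.
rewrite -big_split; apply: eq_bigr => i _.
by rewrite ffunE expfzDr ?comm_factor_neq0.
Qed.

Lemma comm_char_letter a b : comm_char a (letter_wt b) = comm_factor a b.
Proof.
have charE i : comm_char a (delta i) = comm_factor a (inl i).
  rewrite /comm_char (bigD1 i) //= big1 => [|k ne_ki].
    by rewrite ffunE eqxx mulr1.
  by rewrite ffunE (negPf ne_ki).
case: b => i; first exact: charE.
have -> : inr i = dual (inl i) by [].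
rewrite comm_factor_dualr letter_wt_dual.
apply: (mulfI (comm_factor_neq0 a (inl i))).
by rewrite mulfV ?comm_factor_neq0 // -charE -comm_charD /= subrr comm_char0.
Qed.

Section TwistedCommutators.
Variables (A : algType F) (g : letter -> A).
Hypothesis g_comm : forall a b,
  g a * g b = comm_factor a b *: (g b * g a) + (comm_const a b)%:A.

(** * Homogeneous elements, filtered by word length *)

Definition word_prod (w : seq letter) : A := \prod_(a <- w) g a.

Lemma word_prod_cons a w : word_prod (a :: w) = g a * word_prod w.
Proof. exact: big_cons. Qed.

(** The length bound is strict, so that [N = 0] leaves only 0 and [N = 1] only scalars. *)
Inductive homog (N : nat) (p : weight) : A -> Prop :=
| homog_word w of (size w < N)%N & word_wt w = p : homog N p (word_prod w)
| homog0 : homog N p 0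
| homogD u v of homog N p u & homog N p v : homog N p (u + v)
| homogZ c u of homog N p u : homog N p (c *: u).

Lemma homogB N p u v : homog N p u -> homog N p v -> homog N p (u - v).
Proof.
by move=> hu hv; rewrite -scaleN1r; apply: homogD => //; exact: homogZ.
Qed.

Lemma homog_sum I (s : seq I) (G : I -> A) N p :
  (forall i, homog N p (G i)) -> homog N p (\sum_(i <- s) G i).
Proof.
by move=> hG; elim/big_ind: _ => //; [exact: homog0 | exact: homogD].
Qed.

Lemma homog_le M N p u : (M <= N)%N -> homog M p u -> homog N p u.
Proof.
move=> leMN; elim=> [w lt_w wt_w||v w _ IHv _ IHw|c v _ IHv].
- by apply: homog_word => //; exact: leq_trans leMN.
- exact: homog0.
- exact: homogD.
- exact: homogZ.
Qed.

Lemma homog_mul_letter a N p u :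
  homog N p u -> homog N.+1 (letter_wt a + p) (g a * u).
Proof.
elim=> [w lt_w wt_w||v w _ IHv _ IHw|c v _ IHv].
- by rewrite -word_prod_cons; apply: homog_word; rewrite // word_wt_cons wt_w.
- by rewrite mulr0; exact: homog0.
- by rewrite mulrDr; exact: homogD.
- by rewrite -scalerAr; exact: homogZ.
Qed.

Lemma homog0_eq0 p u : homog 0 p u -> u = 0.
Proof.
by elim=> // [v w _ -> _ ->|c v _ ->]; rewrite ?addr0 ?scaler0.
Qed.

Lemma homog1_scalar p u : homog 1 p u -> exists c, u = c%:A.
Proof.
elim=> [[|//] _ _||v w _ [c ->] _ [d ->]|c v _ [d ->]].
- by exists 1; rewrite /word_prod big_nil scale1r.
- by exists 0; rewrite scale0r.
- by exists (c + d); rewrite scalerDl.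
- by exists (c * d); rewrite scalerA.
Qed.

(** Meant for [u] of weight [p]: the character cancels the twists, so that only the constants of
    [g_comm] survive. The weight is an argument because [u] alone need not determine it: 0 has every
    weight. *)
Definition qcomm (a : letter) (p : weight) (u : A) : A :=
  g a * u - comm_char a p *: (u * g a).

Lemma qcomm0 a p : qcomm a p 0 = 0.
Proof. by rewrite /qcomm mulr0 mul0r scaler0 subr0. Qed.

Lemma qcommD a p u v : qcomm a p (u + v) = qcomm a p u + qcomm a p v.
Proof. by rewrite /qcomm mulrDr mulrDl scalerDr opprD addrACA. Qed.

Lemma qcommZ a p c u : qcomm a p (c *: u) = c *: qcomm a p u.
Proof.
by rewrite /qcomm -scalerAr -scalerAl scalerBr !scalerA [c * _]mulrC.
Qed.

Lemma qcomm_nil a : qcomm a (word_wt [::]) (word_prod [::]) = 0.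
Proof.
rewrite /qcomm /word_wt /word_prod !big_nil comm_char0 mulr1 mul1r scale1r.
exact: subrr.
Qed.

(** A twisted Leibniz rule: [comm_char] is multiplicative, so the factor for [b] splits off from
    that for [w]. *)
Lemma qcomm_cons a b w :
  qcomm a (word_wt (b :: w)) (word_prod (b :: w)) =
  comm_const a b *: word_prod w
  + comm_factor a b *: (g b * qcomm a (word_wt w) (word_prod w)).
Proof.
rewrite /qcomm word_wt_cons word_prod_cons comm_charD comm_char_letter.
rewrite mulrA g_comm mulrDl mulr_algl -scalerAl -!mulrA mulrBr scalerBr.
by rewrite -scalerAr !scalerA addrAC [LHS]addrC.
Qed.

Lemma homog_qcomm_word a w :
  homog (size w) (letter_wt a + word_wt w)
      (qcomm a (word_wt w) (word_prod w)).
Proof.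
elim: w => [|b w IH]; first by rewrite qcomm_nil; exact: homog0.
rewrite qcomm_cons; apply: homogD; last first.
  by apply: homogZ; rewrite word_wt_cons addrCA; exact: homog_mul_letter.
(* A letter is deleted only when it is [dual a], and deleting it adds the weight of [a]. *)
have [->|/comm_const_neq_dual ->] := eqVneq b (dual a).
  apply/homogZ/homog_word => //.
  by rewrite word_wt_cons letter_wt_dual addNKr.
by rewrite scale0r; exact: homog0.
Qed.

Lemma homog_qcomm a N p u :
  homog N.+1 p u -> homog N (letter_wt a + p) (qcomm a p u).
Proof.
elim=> [w lt_w <-||v w _ IHv _ IHw|c v _ IHv].
- by apply: (@homog_le (size w)) (homog_qcomm_word a w).
- by rewrite qcomm0; exact: homog0.
- by rewrite qcommD; exact: homogD.
- by rewrite qcommZ; exact: homogZ.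
Qed.

(** By the Leibniz rule, [qcomm a] deletes each occurrence of [dual a] in turn, and multiplying by
    [g (dual a)] restores the letter. Moving it back into place costs only shorter words, as [a] and
    [dual a] have inverse factors. *)
Lemma euler_letter a w :
  homog (size w) (word_wt w)
   (comm_const a (dual a) *:
      (g (dual a) * qcomm a (word_wt w) (word_prod w))
    - (count_mem (dual a) w)%:R *: word_prod w).
Proof.
set e := comm_const a (dual a).
elim: w => [|b w IH].
  by rewrite qcomm_nil mulr0 scaler0 scale0r subr0; exact: homog0.
rewrite qcomm_cons.
(* The induction hypothesis multiplied by [g b], plus the remainder from exchanging [dual a] and
   [b]. *)
have -> (R : A) : e *: (g (dual a) * (comm_const a b *: word_prod w
              + comm_factor a b *: (g b * R)))
        - (count_mem (dual a) (b :: w))%:R *: word_prod (b :: w)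
  = g b * (e *: (g (dual a) * R) - (count_mem (dual a) w)%:R *: word_prod w)
    + (e * comm_factor a b * comm_const (dual a) b) *: R.
  rewrite /= word_prod_cons natrD scalerDl mulrBr mulrDr scalerDr.
  have -> : g (dual a) * (comm_factor a b *: (g b * R))
      = g b * (g (dual a) * R)
        + (comm_factor a b * comm_const (dual a) b) *: R.
    rewrite -scalerAr (mulrA (g (dual a))) (g_comm (dual a)) mulrDl mulr_algl.
    rewrite scalerDr scalerA.
    rewrite -scalerAl scalerA [comm_factor a b * comm_factor _ _]mulrC.
    by rewrite comm_factor_dual scale1r mulrA.
  rewrite -!scalerAr scalerDr !scalerA mulrA.
  (* The head letter adds one to the count exactly when it is [dual a]; the sign [e] squares to
     1. *)
  have -> : (e * comm_const a b) *: (g (dual a) * word_prod w)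
            = (b == dual a)%:R *: (g b * word_prod w).
    have [->|/comm_const_neq_dual ->] := eqVneq b (dual a).
      by rewrite comm_const_dual_sqr.
    by rewrite mulr0 !scale0r.
  rewrite opprD addrACA subrr add0r addrAC.
  by rewrite mulrA.
rewrite word_wt_cons; apply: homogD; first exact: homog_mul_letter.
(* The remainder survives only for [b = a], where [qcomm a] of the tail has the right weight and is
   short enough. *)
have [->|] := eqVneq b a.
  by apply: homogZ; apply: homog_le (homog_qcomm_word a w).
rewrite -{1}[a]dualK => /comm_const_neq_dual ->.
by rewrite mulr0 scale0r; exact: homog0.
Qed.

(* An analogue of Euler's identity: in top degree, [qcomm a] acts as plus or
   minus the partial derivative with respect to the letter dual to [a]. *)
Lemma euler N p u : homog N.+1 p u ->
  homog N p (\sum_a comm_const a (dual a) *: (g (dual a) * qcomm a p u)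
           - N%:R *: u).
Proof.
elim=> [w lt_w <-||v w _ IHv _ IHw|c v _ IHv].
- move: lt_w; rewrite ltnS leq_eqVlt => /predU1P[<-|lt_w].
    (* For a word of maximal length [N], the counts of all letters add up to [N]. *)
    have sum_dual : (\sum_a count_mem (dual a) w = size w)%N.
      by rewrite -[RHS]sum_count_mem [RHS](reindex_inj (inv_inj dualK)).
    rewrite -[X in X%:R]sum_dual natr_sum scaler_suml -sumrB.
    apply: homog_sum => a.
    exact: euler_letter.
  (* For a shorter word, both terms already lie below the length bound. *)
  apply: homogB; last by apply/homogZ/homog_word.
  apply: homog_sum => a; apply: homogZ; apply: (@homog_le (size w).+1) => //.
  have -> : word_wt w = letter_wt (dual a) + (letter_wt a + word_wt w).
    by rewrite letter_wt_dual addKr.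
  by rewrite {2}letter_wt_dual addKr; apply/homog_mul_letter/homog_qcomm_word.
- rewrite scaler0 subr0; apply: homog_sum => a.
  by rewrite qcomm0 mulr0; exact/homogZ/homog0.
- have := homogD IHv IHw; congr (homog _ _ _).
  rewrite addrACA -big_split -opprD -scalerDr; congr (_ - _).
  by apply: eq_bigr => a _ /=; rewrite -scalerDr -mulrDr qcommD.
- have := homogZ c IHv; congr (homog _ _ _).
  rewrite scalerBr scaler_sumr !scalerA [N%:R * c]mulrC; congr (_ - _).
  apply: eq_bigr => a _.
  by rewrite qcommZ -scalerAr !scalerA mulrC.
Qed.

(** * Simplicity *)

Hypothesis charF0 : [pchar F] =i pred0.

(** Induction on the length bound. A nonzero [qcomm a p u] is a shorter element of the ideal. If all
    of them vanish, Euler's identity shows that [u] itself equals a combination of shorter words. *)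
Lemma ideal_homog_one (I : set A) N p u :
  two_sided_ideal I -> homog N p u -> I u -> u != 0 -> I 1.
Proof.
move=> Iideal; have [_ _ Il Ir] := Iideal.
elim: N p u => [|N IH] p u hu Iu u_neq0.
  by case/eqP: u_neq0; exact: homog0_eq0 hu.
have Iqcomm a : I (qcomm a p u).
  by apply: idealB => //; [exact: Il | apply: idealZ => //; exact: Ir].
case: (pselect (exists a, qcomm a p u != 0)) => [[a]|qcomm_eq0].
  exact: IH (homog_qcomm a hu) (Iqcomm a).
(* At length bound 1 the coefficient in Euler's identity is 0, so scalars are handled directly. *)
case: N => [|N] in IH hu *.
  have [c uE] := homog1_scalar hu.
  have c_neq0 : c != 0.
    by apply: contraNneq u_neq0 => c0; rewrite uE c0 scale0r.
  by rewrite -[1](scalerK c_neq0) -uE; exact: idealZ.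
apply: (IH p u) => //.
(* The sum in Euler's identity is zero, and [N.+1] is invertible in characteristic 0. *)
have := homogZ (- (N.+1%:R : F)^-1) (euler hu).
rewrite big1 => [|a _]; last first.
  suff -> : qcomm a p u = 0 by rewrite mulr0 scaler0.
  by apply: contrapT => /eqP ne0; apply: qcomm_eq0; exists a.
by rewrite sub0r scaleNr scalerN opprK scalerA mulVf ?natf_neq0 ?scale1r.
Qed.

(** * Degree operators and weight components *)

Hypothesis L_diag : forall i : 'I_n, L i i = 1.

Definition degree_op (j : 'I_n) : A := g (inl j) * g (inr j).

(** The twists of y_j and x_j past [b] are inverse to each other, so an ordinary commutator leaves
    only the constants of [g_comm]. *)
Lemma degree_op_letter j b :
  degree_op j * g b - g b * degree_op j = (letter_wt b j)%:~R *: g b.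
Proof.
have -> : degree_op j * g b - g b * degree_op j =
    comm_const (inr j) b *: g (inl j)
    + (comm_factor (inr j) b * comm_const (inl j) b) *: g (inr j).
  rewrite /degree_op -mulrA (g_comm (inr j) b) mulrDr -scalerAr.
  rewrite (mulrA _ (g b)) (g_comm (inl j) b) mulrDl -scalerAl mulr_algl.
  rewrite scalerDr !scalerA (comm_factor_dual (inl j)) scale1r.
  rewrite mulr_algr -!mulrA.
  by rewrite addrAC [_ + _ *: g (inr j)]addrC addrK addrC.
case: b => i /=; rewrite !ffunE eq_sym; case: eqP => [->|_].
- by rewrite L_diag mulr0 scale0r addr0.
- by rewrite mulr0 !scale0r addr0.
- by rewrite L_diag scale0r add0r mul1r.
- by rewrite oppr0 mulr0 !scale0r addr0.
Qed.

(** A commutator is a derivation, so the eigenvalues of the letters add up along a word. *)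
Lemma degree_op_homog j N p u :
  homog N p u -> degree_op j * u - u * degree_op j = (p j)%:~R *: u.
Proof.
elim=> [w _ <-||v w _ IHv _ IHw|c v _ IHv].
- elim: w => [|b w IH].
    by rewrite /word_prod /word_wt !big_nil ffunE mulr1 mul1r subrr scale0r.
  rewrite word_wt_cons word_prod_cons ffunE intrD scalerDl.
  have commE (x y z : A) :
      x * (y * z) - y * z * x = (x * y - y * x) * z + y * (x * z - z * x).
    by rewrite mulrBl mulrBr !mulrA addrA subrK.
  by rewrite commE degree_op_letter IH -scalerAl -scalerAr.
- by rewrite mulr0 mul0r subr0 scaler0.
- by rewrite mulrDr mulrDl opprD addrACA IHv IHw scalerDr.
- by rewrite -scalerAr -scalerAl -scalerBr IHv !scalerA mulrC.
Qed.

(* [degree_op j] acts on the weight space of [p] as the scalar [p j], so an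
   ideal contains every weight component of each of its elements. *)
Lemma ideal_components (I : set A) (s : seq weight) (v : weight -> A) :
  two_sided_ideal I -> uniq s -> (forall p, exists N, homog N p (v p)) ->
  I (\sum_(p <- s) v p) -> forall p, p \in s -> I (v p).
Proof.
move=> Iideal; have [I0 ID Il Ir] := Iideal.
elim: s v => [//|p s IH] v /andP[p_notin s_uniq] v_hom Isum.
have Is q : q \in s -> I (v q).
  move=> q_s.
  have /existsP[j ne_j] : [exists j, q j != p j].
    rewrite -negb_forall; apply: contraNN p_notin => /forallP eq_qp.
    by rewrite (_ : p = q) //; apply/ffunP => j; apply/esym/eqP.
  (* Applying ad ([degree_op j]) - p_j removes the component at [p] and rescales the others. *)
  have Iscaled : I (\sum_(r <- s) (r j - p j)%:~R *: v r).
    set u := \sum_(r <- p :: s) v r in Isum.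
    have -> : \sum_(r <- s) (r j - p j)%:~R *: v r
        = degree_op j * u - u * degree_op j - (p j)%:~R *: u.
      have -> : degree_op j * u - u * degree_op j
          = \sum_(r <- p :: s) (r j)%:~R *: v r.
        rewrite mulr_sumr mulr_suml -sumrB; apply: eq_bigr => r _.
        by have [N /degree_op_homog->] := v_hom r.
      rewrite scaler_sumr -sumrB big_cons subrr add0r.
      by apply: eq_bigr => r _; rewrite intrB scalerBl.
    by apply: idealB; [|apply: idealB; [|exact: Il|exact: Ir]|exact: idealZ].
  (* The induction runs on the rescaled family; the factor q_j - p_j is then inverted, by
     characteristic 0 and the choice of [j]. *)
  have := IH (fun r => (r j - p j)%:~R *: v r) s_uniq _ Iscaled q q_s.
  move=> /(_ _)/(idealZ (q j - p j)%:~R^-1 Iideal).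
  rewrite scalerK ?intf_neq0 ?subr_eq0 //; apply.
  by move=> r; have [N hN] := v_hom r; exists N; exact: homogZ.
move=> q; rewrite inE => /predU1P[->|]; last exact: Is.
have <- : \sum_(r <- p :: s) v r - \sum_(r <- s) v r = v p.
  by rewrite big_cons addrK.
apply: idealB => //; rewrite big_seq_cond.
by apply: ideal_sum => // r /andP[/Is].
Qed.

Hypothesis word_span : forall u : A,
  exists s : seq (F * seq letter), u = \sum_(cw <- s) cw.1 *: word_prod cw.2.

(** The words in a chosen expression of [u] are grouped by weight. *)
Lemma weight_decomposition (u : A) : exists (s : seq weight) (v : weight -> A),
  [/\ uniq s, forall p, exists N, homog N p (v p) & u = \sum_(p <- s) v p].
Proof.
have [l ->] := word_span u.
pose wt (cw : F * seq letter) := word_wt cw.2.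
exists (undup (map wt l)).
exists (fun p => \sum_(cw <- l | wt cw == p) cw.1 *: word_prod cw.2).
split=> [|p|]; first exact: undup_uniq.
  (* One length bound serves all weights; the successor makes it strict. *)
  exists (\max_(cw <- l) (size cw.2).+1)%N.
  rewrite [X in homog _ _ X]big_seq_cond.
  apply: (big_ind (homog _ p)); [exact: homog0 | exact: homogD |].
  move=> cw /andP[cw_l /eqP wt_cw]; apply/homogZ/homog_word => //.
  by rewrite (big_rem cw) //= leq_max leqnn.
(* After the exchange of sums, each word is counted once, at its own weight. *)
rewrite (exchange_big_dep predT) //= big_seq [RHS]big_seq.
apply: eq_bigr => cw cw_l; rewrite (eq_bigl (pred1 (wt cw))); last first.
  by move=> p; rewrite eq_sym.
rewrite -big_filter filter_pred1_uniq ?undup_uniq ?big_seq1 //.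
by rewrite mem_undup map_f.
Qed.

Lemma twisted_weyl_simple : simple_ring A.
Proof.
split=> [|I Iideal]; first exact: oner_neq0.
have [I0 _ Il _] := Iideal.
case: (pselect (exists2 u, I u & u != 0)) => [[u Iu u_neq0]|I_eq0]; last first.
  left; apply/seteqP; split=> [u Iu|u -> //].
  by apply: contrapT => /eqP u_neq0; apply: I_eq0; exists u.
right; apply/seteqP; split=> // a _; rewrite -[a]mulr1; apply: Il.
have [s [v [s_uniq v_hom uE]]] := weight_decomposition u.
have Iv : forall p, p \in s -> I (v p).
  by apply: ideal_components => //; rewrite -uE.
have /hasP[p p_s vp_neq0] : has (fun p => v p != 0) s.
  apply: contraNT u_neq0 => /hasPn v_eq0; rewrite uE big_seq big1 // => p p_s.
  by apply/eqP; have := v_eq0 p p_s; rewrite negbK.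
by have [N hN] := v_hom p; exact: ideal_homog_one hN (Iv p p_s) vp_neq0.
Qed.
End TwistedCommutators.
End TwistedWeyl.

(** * The presented algebra *)

Section WeylAlgType.
Variables (F : fieldType) (n : nat) (L : 'M[F]_n).
Hypothesis L_neq0 : forall i j : 'I_n, L i j != 0.
Hypothesis L_inv : forall i j : 'I_n, L j i = (L i j)^-1.

(* A copy of [weyl_alg L] carrying the hypotheses that make it a nonzero ring,
   as required by [algType]. *)
Definition twisted_weyl
  of (forall i j, L i j != 0) & (forall i j, L j i = (L i j)^-1) : Type :=
  weyl_alg L.

Local Notation W := (twisted_weyl L_neq0 L_inv).

HB.instance Definition _ := GRing.PzRing.copy W (weyl_alg L).
HB.instance Definition _ := GRing.Lmodule.copy W (weyl_alg L).
HB.instance Definition _ :=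
  GRing.PzSemiRing_isNonZero.Build W (weyl_alg_nontrivial L_neq0 L_inv).
HB.instance Definition _ :=
  GRing.Lmodule_isLalgebra.Build F W (@presented_scaleAl F _ (weyl_relator L)).
HB.instance Definition _ :=
  GRing.Lalgebra_isAlgebra.Build F W (@presented_scaleAr F _ (weyl_relator L)).

Local Notation letter := ('I_n + 'I_n)%type.
Local Notation pi := (@presented_pi _ (weyl_relator L)).

Definition weyl_gen (a : letter) : W := pi (free_gen F a).

Lemma weyl_gen_relation c a b a' b' :
  weyl_relator L
    (free_gen F a * free_gen F b - c *: (free_gen F a' * free_gen F b')) ->
  weyl_gen a * weyl_gen b = c *: (weyl_gen a' * weyl_gen b').
Proof.
move=> /(@ideal_span_sub _ (weyl_relator L)) rel.
suff /presented_piP : free_gen F a * free_gen F b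
    - c *: (free_gen F a' * free_gen F b') \in ideal_span_pred (weyl_relator L).
  by rewrite linearZ !rmorphM.
exact/asboolP.
Qed.

Definition letter_index (a : letter) : 'I_n :=
  match a with inl j => j | inr j => j end.

Lemma weyl_gen_comm_lt a b : (letter_index b < letter_index a)%N ->
  weyl_gen a * weyl_gen b = comm_factor L a b *: (weyl_gen b * weyl_gen a).
Proof.
case: a b => j [] i /= lt_ij; apply: weyl_gen_relation.
- exact: (Weyl_yy L lt_ij).
- exact: (Weyl_yx L lt_ij).
- exact: (Weyl_xy L lt_ij).
- exact: (Weyl_xx L lt_ij).
Qed.

Lemma weyl_gen_commutator j :
  weyl_gen (inr j) * weyl_gen (inl j) =
  weyl_gen (inl j) * weyl_gen (inr j) + 1.
Proof.
have /(@ideal_span_sub _ (weyl_relator L)) rel := Weyl_comm L j.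
have /presented_piP : free_x F j * free_y F j - free_y F j * free_x F j - 1
    - 0 \in ideal_span_pred (weyl_relator L) by rewrite subr0; exact/asboolP.
rewrite !raddfB raddf0 /= !presented_piM => /eqP.
by rewrite subr_eq0 subr_eq addrC => /eqP.
Qed.

Hypothesis L_diag : forall i : 'I_n, L i i = 1.

Lemma comm_factor_sym a b : comm_factor L a b * comm_factor L b a = 1.
Proof. by case: a b => j [] i /=; rewrite (L_inv i j) ?mulfV ?mulVf. Qed.

(** The presentation covers pairs whose left letter has the larger index. The opposite order follows
    by inverting the factor, and equal indices by [L_diag] and the commutator relation. *)
Lemma weyl_gen_comm a b :
  weyl_gen a * weyl_gen b =
  comm_factor L a b *: (weyl_gen b * weyl_gen a) + (comm_const F a b)%:A.
Proof.
have const0 : letter_index b != letter_index a -> comm_const F a b = 0.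
  by case: a b => j [] i //= /negPf ->; rewrite ?oppr0.
have [lt_ba|lt_ab|eq_ba] := ltngtP (letter_index b) (letter_index a).
- by rewrite weyl_gen_comm_lt // const0 ?scale0r ?addr0 // -val_eqE ltn_eqF.
- rewrite [weyl_gen b * _]weyl_gen_comm_lt // scalerA comm_factor_sym scale1r.
  by rewrite const0 ?scale0r ?addr0 // -val_eqE gtn_eqF.
case: a b eq_ba {const0} => j [] i /= /val_inj ->; rewrite L_diag scale1r.
- by rewrite scale0r addr0.
- by rewrite eqxx scaleN1r weyl_gen_commutator addrK.
- by rewrite eqxx scale1r weyl_gen_commutator.
- by rewrite scale0r addr0.
Qed.

Lemma pi_word (w : {fmonom letter}) :
  pi (mkmalgU w 1) = word_prod weyl_gen w.
Proof.
rewrite -[w in LHS]fmK; elim: (w : seq letter) => [|a s IH].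
  rewrite /word_prod big_nil -fmoneE.
  by rewrite -(rmorph1 pi) -[1 in RHS](@mpolyC1E {fmonom letter} F).
rewrite word_prod_cons -IH -rmorphM /free_gen mkmalgUM mulr1.
by congr (pi (mkmalgU _ _)); rewrite [mmul _ _]fmmulE fmU.
Qed.

Lemma weyl_word_span (u : W) : exists s : seq (F * seq letter),
  u = \sum_(cw <- s) cw.1 *: word_prod weyl_gen cw.2.
Proof.
pose r : free_alg F letter := presented_repr (u : weyl_alg L).
(* The coefficients and words of a chosen representative in the free algebra. *)
exists [seq (mcoeff w r, w : seq letter) | w <- finmap.enum_fset (msupp r)].
have -> : u = pi r by rewrite presented_reprK.
rewrite big_map [X in pi X]monalgE raddf_sum; apply: eq_bigr => w _ /=.
rewrite -pi_word -linearZ; congr (pi _).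
by apply/malgP => v; rewrite mcoeffZ !mcoeffU mulrnAr mulr1.
Qed.

End WeylAlgType.

Theorem theorem6p5 (F : fieldType) (charF0 : [pchar F] =i pred0)
  (n : nat) (n_gt0 : (0 < n)%N) (L : 'M[F]_n)
  (L_neq0 : forall i j : 'I_n, L i j != 0)
  (L_inv : forall i j : 'I_n, L j i = (L i j)^-1)
  (L_diag : forall i : 'I_n, L i i = 1) :
  simple_ring (weyl_alg L).
Proof.
(* The ring [twisted_weyl L_neq0 L_inv] unfolds to [weyl_alg L], so its simplicity is the goal. *)
have simpleW := @twisted_weyl_simple _ _ L L_neq0 L_inv
  (twisted_weyl L_neq0 L_inv) (@weyl_gen _ _ _ L_neq0 L_inv).
apply: simpleW => //; first exact: weyl_gen_comm.
exact: weyl_word_span.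
Qed.
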